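(* Let $(X,d)$ be a metric space with $|X|\geqslant 3$ all of whose points are accumulation points of $X$, and let $T\colon X\to X$ be a continuous generalized Chatterjea type mapping with constant $\gamma\in[0,\frac14)$. Then $T$ is a Chatterjea type mapping.
   Context: For a metric space $(X,d)$ with $|X|\geqslant 3$, a mapping $T\colon X\to X$ is called a generalized Chatterjea type mapping with constant $\gamma$ (where $\gamma\in[0,\frac13)$) if $$d(Tx,Ty)+d(Ty,Tz)+d(Tx,Tz)\leqslant \gamma\,(d(x,Ty)+d(x,Tz)+d(y,Tx)+d(y,Tz)+d(z,Tx)+d(z,Ty))$$ holds for all three pairwise distinct points $x,y,z\in X$. A mapping $T\colon X\to X$ is a Chatterjea type mapping if there exists $\beta\in[0,\frac12)$ such that $d(Tx,Ty)\leqslant\beta\,(d(x,Ty)+d(y,Tx))$ for all $x,y\in X$. A point $x\in X$ is an accumulation point of $X$ if every open ball centered at $x$ contains infinitely many points of $X$. *)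

(* Defs.v *)
From mathcomp Require Import all_boot all_order all_algebra.
From mathcomp Require Import all_classical all_reals all_analysis.
Set Implicit Arguments.
Unset Strict Implicit.
Unset Printing Implicit Defensive.
Import Order.TTheory GRing.Theory Num.Theory.
Local Open Scope classical_set_scope.
Local Open Scope ring_scope.

Definition generalized_chatterjea (R : realType) (X : metricType R)
    (gamma : R) (T : X -> X) : Prop :=
  0 <= gamma < 1 / 3 /\
  forall x y z : X, x <> y -> y <> z -> x <> z ->
    mdist (T x) (T y) + mdist (T y) (T z) + mdist (T x) (T z) <=
    gamma * (mdist x (T y) + mdist x (T z) + mdist y (T x)
             + mdist y (T z) + mdist z (T x) + mdist z (T y)).

Definition chatterjea (R : realType) (X : metricType R) (T : X -> X) : Prop :=
  exists2 beta : R, 0 <= beta < 1 / 2 &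
    forall x y : X,
      mdist (T x) (T y) <= beta * (mdist x (T y) + mdist y (T x)).

(* On a metricType, [ball x e] is the open ball [set y | mdist x y < e]
   (lemma ballEmdist). The library's [limit_point] only asks for one other
   point in each neighborhood, hence the separate definition. *)
Definition accumulation_point (R : realType) (X : metricType R) (x : X) : Prop :=
  forall e : R, 0 < e -> infinite_set (ball x e).

(* Main.v *)
Require Import Defs.
From mathcomp Require Import all_boot all_order all_algebra.
From mathcomp Require Import all_classical all_reals all_analysis.
From mathcomp Require Import lra.
Import Order.TTheory GRing.Theory Num.Theory.
Local Open Scope classical_set_scope.
Local Open Scope card_scope.
Local Open Scope ring_scope.

(** Letting z tend to x in the three-point inequality gives, by continuity,
    d(Tx,Ty) <= gamma (d(x,Ty) + d(y,Tx) + d(x,Tx)). Adding the same bound with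
    x and y exchanged and using d(x,Tx) <= d(x,Ty) + d(Tx,Ty) yields
    2 (1 - gamma) d(Tx,Ty) <= 3 gamma (d(x,Ty) + d(y,Tx)), and
    3 gamma / (2 (1 - gamma)) < 1/2 exactly when gamma < 1/4. *)

(** An infinite ball cannot lie inside the pair [[set x; y]]. Avoiding [y] as well as [x] makes the
    three points pairwise distinct, as the three-point inequality demands. *)
Lemma accumulation_point_near (R : realType) (X : metricType R) (x y : X)
    (P : set X) :
  accumulation_point x -> nbhs x P -> exists z, [/\ P z, z <> x & z <> y].
Proof.
move=> x_acc /nbhs_ballP[e /= e0 eP]; apply: contrapT => noz.
apply: (x_acc e e0); apply: (@sub_finite_set _ _ [set x; y]).
  move=> z /eP Pz; apply: contrapT => /not_orP[zx zy].
  by apply: noz; exists z.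
exact: finite_set2.
Qed.

Lemma generalized_chatterjea_limit (R : realType) (X : metricType R)
    (gamma : R) (T : X -> X) (x y : X) :
  accumulation_point x -> {for x, continuous T} ->
  generalized_chatterjea gamma T -> x <> y ->
  mdist (T x) (T y) <= gamma * (mdist x (T y) + mdist y (T x) + mdist x (T x)).
Proof.
move=> x_acc Tx_cont [/andP[g0 g3] Tgen] xy.
apply/ler_addgt0Pr => e e0.
have near_x : nbhs x (ball x e `&` T @^-1` ball (T x) e).
  by apply: filterI; [exact: nbhsx_ballx|exact/Tx_cont/nbhsx_ballx].
have [z [[]]] := accumulation_point_near _ _ x y _ x_acc near_x.
rewrite /preimage /= !ballEmdist /= => xz Txz zx zy.
have := Tgen x y z xy (nesym zy) (nesym zx).
have tri := @metric_triangle R X.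
have sym := @metric_sym R X.
(* Through [T z], the left side of the three-point inequality is at least twice d(Tx,Ty). *)
have := tri (T x) (T z) (T y); rewrite (sym (T z) (T y)) => h0.
have h1 := tri x (T x) (T z); have h2 := tri y (T x) (T z).
have h3 := tri z x (T x); have h4 := tri z x (T y).
rewrite (sym z x) in h3 h4.
move=> le.
(* Each of the four distances involving [z] or [T z] costs one [e]; in the limit every distance
   occurs twice. *)
have : gamma * (mdist x (T y) + mdist x (T z) + mdist y (T x)
             + mdist y (T z) + mdist z (T x) + mdist z (T y)) <=
  gamma * (2 * (mdist x (T y) + mdist y (T x) + mdist x (T x)) + 4 * e).
  by apply: ler_wpM2l => //; lra.
(* After halving, the error is 2 gamma e, at most 2/3 e. *)
have : gamma * e <= 1 / 3 * e by apply: ler_wpM2r; lra.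
lra.
Qed.

Theorem corollary2p3 (R : realType) (X : metricType R) (T : X -> X) (gamma : R)
    (X_ge3 : `I_3 #<= [set: X])
    (X_acc : forall x : X, accumulation_point x)
    (T_cont : continuous T)
    (gamma_bnd : 0 <= gamma < 1 / 4)
    (T_gen : generalized_chatterjea gamma T) :
  chatterjea T.
Proof.
have /andP[g0 g4] := gamma_bnd.
have d0 : 0 < 2 * (1 - gamma) by lra.
exists (3 * gamma / (2 * (1 - gamma))).
  rewrite divr_ge0 ?ltr_pdivrMr //=; lra.
(* The limit bound needs distinct points; for equal ones the left side is 0. *)
move=> x y; have [<-|/eqP xy] := eqVneq x y.
  by rewrite mdistxx mulr_ge0 ?addr_ge0 ?mdist_ge0 // divr_ge0 //; lra.
rewrite mulrAC ler_pdivlMr //.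
have tri := @metric_triangle R X.
have h1 := generalized_chatterjea_limit _ _ _ _ _ _ (X_acc x) (T_cont x) T_gen xy.
have h2 := generalized_chatterjea_limit _ _ _ _ _ _ (X_acc y) (T_cont y) T_gen (nesym xy).
have h3 := tri x (T y) (T x); have h4 := tri y (T x) (T y).
rewrite (metric_sym (T y)) in h2 h3.
(* The term 2 gamma d(Tx,Ty) moves to the left, which produces the denominator 2 (1 - gamma). *)
have : gamma * (mdist x (T x) + mdist y (T y)) <=
  gamma * (mdist x (T y) + mdist y (T x) + 2 * mdist (T x) (T y)).
  by apply: ler_wpM2l => //; lra.
lra.
Qed.
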